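(* Let $p>3$ be a prime and let $b,c\in\mathbb{Z}$ with $p\nmid b+2c$. Put $\lambda=\frac{2c}{b+2c}$. Then $$\sum_{k=0}^{(p-1)/2}\frac{\binom{2k}{k}}{4^k(b+2c)^{2k}}T_{2k}(b,c^2)\equiv(-\lambda)^{(p-1)/2}+(-1)^{(p-1)/2}\,p\sum_{\substack{0\le j\le p-1\\ j\ne (p-1)/2}}\frac{\lambda^j}{2j+1}\pmod{p^2}.$$
   Context: For $n\in\mathbb{N}=\{0,1,2,\ldots\}$ and $b,c\in\mathbb{C}$, the generalized central trinomial coefficient is $T_n(b,c)=[x^n](x^2+bx+c)^n=\sum_{j=0}^{\lfloor n/2\rfloor}\binom{n}{2j}\binom{2j}{j}b^{n-2j}c^j$; equivalently, it is the constant term of $(b+x+cx^{-1})^n$. Congruences between rational numbers modulo $p^2$ are understood in the ring of rational numbers whose denominators are prime to $p$ (equivalently in $\mathbb{Z}_p$). The convention $\lambda^0=1$ is used, also when $\lambda=0$. *)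

(* Defs.v *)
From mathcomp Require Import all_boot all_order all_algebra.
Set Implicit Arguments.
Unset Strict Implicit.
Unset Printing Implicit Defensive.
Import Order.TTheory GRing.Theory Num.Theory.
Local Open Scope ring_scope.

Definition trinomial_coef (R : comNzRingType) (n : nat) (b c : R) : R :=
  (('X^2 + b *: 'X + c%:P) ^+ n)`_n.

(* Membership in the subring of rationals with denominator prime to p. *)
Definition p_integral (p : nat) (x : rat) : bool := coprime p `|denq x|.

(* Congruence modulo m in that subring; both sides are required to lie in it. *)
Definition p_congr (p m : nat) (x y : rat) : Prop :=
  [/\ p_integral p x, p_integral p y
    & exists2 z : rat, p_integral p z & x - y = m%:R * z].

(* Main.v *)
Require Import Defs.
From HB Require Import structures.
From mathcomp Require Import all_boot all_order all_algebra cyclic.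
From mathcomp Require Import ring zify.
Set Implicit Arguments.
Unset Strict Implicit.
Unset Printing Implicit Defensive.
Import Order.TTheory GRing.Theory Num.Theory.
Local Open Scope ring_scope.

(** The substitution X^2 + b X + c^2 = (X - c)^2 + (b + 2c) X expands
    T_n(b, c^2) / (b + 2c)^n in powers of lambda.  With
    w_i = 'C(2i, i) (-1/2)^i (halfbin below) it equals
    sum_j 'C(n, j) w_j lambda^j, so with h = (p - 1)/2 the left-hand side is the
    polynomial sum_(j < p) U_j lambda^j, where
      U_j = w_j sum_(k <= h) 'C(2k, k) / 4^k 'C(2k, j)
    does not involve b and c.  The right-hand side is the sum of
    (-1)^h p / (2j + 1) lambda^j over j < p, the term j = h being
    (-lambda)^h because 2h + 1 = p.  The theorem therefore follows from
    the congruence U_j = (-1)^h p / (2j + 1) modulo p^2 for each j < p.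

    Write a = 'C(2h, h) / 4^h.  The inner sum of U_j satisfies a first-order
    recurrence in j, which the factor w_j turns into a telescoping one; this
    gives the exact evaluation (lambda_coefE)
      (2j + 1) U_j = p a sum_(i <= j) 'C(p, i) w_i.

    If j <> h, then 2j + 1 is prime to p, and modulo p the sum on the right
    reduces to its term i = 0, because p divides 'C(p, i) for 0 < i < p.  So
    the congruence comes down to a = (-1)^h modulo p.

    If j = h, dividing by p leaves U_h = a sum_(i <= h) 'C(p, i) w_i, and both
    factors are needed modulo p^2.  The sum extended to all i <= p vanishes,
    being the constant term of (- (x + 1/x) / 2)^p with p odd.  For h < i < p
    both 'C(p, i) and 'C(2i, i) are divisible by p, so only i = p contributes
    to the rest, and 'C(2p, p) = 2 modulo p^2 makes the sum congruent to 4^(-h).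
    The other factor is a = (-4)^h modulo p^2, a form of Morley's congruence
    'C(2h, h) = (-1)^h 4^(p - 1) (central_bin_mod_p2).  The product is
    (-1)^h. *)

(** * Rationals integral at p *)

(** Unlike the reduced denominator, a denominator that is merely prime to p is
    easy to exhibit for a difference or a product. *)
Lemma p_integralP (p : nat) (x : rat) :
  reflect (exists n : int, exists2 d : nat, coprime p d & x * d%:R = n%:~R)
          (p_integral p x).
Proof.
apply: (iffP idP) => [px|[n [d pd xd]]].
  by exists (numq x), `|denq x|%N => //; rewrite numqE pmulrn absz_denq.
apply: coprime_dvdr pd.
have : (denq x %| numq x * d)%Z.
  apply/dvdzP; exists n; apply: (@intr_inj rat).
  rewrite !rmorphM /= -xd numqE /= -!pmulrn; ring.
by rewrite Gauss_dvdzr // coprimezE coprime_sym coprime_num_den.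
Qed.

Fact p_integral_subring (p : nat) : subring_closed (p_integral p).
Proof.
split=> [|x y /p_integralP[n [d pd xd]] /p_integralP[m [e pe ye]]
         |x y /p_integralP[n [d pd xd]] /p_integralP[m [e pe ye]]];
  apply/p_integralP.
- by exists 1, 1%N; rewrite ?coprimen1.
- exists (n * e - m * d), (d * e)%N; first by rewrite coprimeMr pd.
  rewrite natrM rmorphB !rmorphM /= -xd -ye -!pmulrn; ring.
exists (n * m), (d * e)%N; first by rewrite coprimeMr pd.
rewrite natrM rmorphM /= -xd -ye; ring.
Qed.

HB.instance Definition _ (p : nat) :=
  GRing.isSubringClosed.Build rat (p_integral p) (p_integral_subring p).

Lemma p_integral_div (p : nat) (a d : int) :
  coprime p `|d| -> p_integral p (a%:~R / d%:~R).
Proof.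
move=> pd; have [->|d0] := eqVneq d 0.
  by rewrite invr0 mulr0; apply: rpred0.
apply/p_integralP; exists (a * Num.sg d), `|d|%N => //.
have d0' : d%:~R != 0 :> rat by rewrite intr_eq0.
rewrite pmulrn abszE [`|d|]normrEsg !rmorphM /=.
by field.
Qed.

Lemma p_integral_natV (p n : nat) : coprime p n -> p_integral p n%:R^-1.
Proof. by move=> pn; rewrite -[_^-1]mul1r; apply: (@p_integral_div p 1 n). Qed.

Section Congr.
Variables (p m : nat).
Implicit Types x y z : rat.

Lemma p_congr_refl x : p_integral p x -> p_congr p m x x.
Proof. by move=> px; split=> //; exists 0; [apply: rpred0|rewrite subrr mulr0]. Qed.

Lemma p_congr_trans y x z : p_congr p m x y -> p_congr p m y z -> p_congr p m x z.
Proof.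
move=> [px py [u pu e]] [_ pz [v pv f]]; split=> //.
exists (u + v); first exact: rpredD.
by rewrite mulrDr -e -f addrA subrK.
Qed.

Lemma p_congrD x y x' y' :
  p_congr p m x y -> p_congr p m x' y' -> p_congr p m (x + x') (y + y').
Proof.
move=> [px py [u pu e]] [px' py' [v pv f]]; split; [exact: rpredD..|].
exists (u + v); first exact: rpredD.
by rewrite mulrDr -e -f addrACA opprD.
Qed.

Lemma p_congrN x y : p_congr p m x y -> p_congr p m (- x) (- y).
Proof.
move=> [px py [z pz e]]; split; [exact: rpredNr..|].
by exists (- z); [exact: rpredNr | rewrite mulrN -e opprD].
Qed.

Lemma p_congrM x y x' y' :
  p_congr p m x y -> p_congr p m x' y' -> p_congr p m (x * x') (y * y').
Proof.
move=> [px py [u pu e]] [px' py' [v pv f]]; split; [exact: rpredM..|].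
exists (u * x' + y * v); first by apply: rpredD; apply: rpredM.
rewrite mulrDr mulrA -e mulrCA -f; ring.
Qed.

Lemma p_congr_sum (I : Type) (r : seq I) (P : pred I) (F G : I -> rat) :
  (forall i, P i -> p_congr p m (F i) (G i)) ->
  p_congr p m (\sum_(i <- r | P i) F i) (\sum_(i <- r | P i) G i).
Proof.
move=> FG; elim/big_rec2: _ => [|i x y Pi xy]; first exact/p_congr_refl/rpred0.
by apply: p_congrD => //; apply: FG.
Qed.

Lemma p_congr_sum0 (I : eqType) (r : seq I) (F : I -> rat) :
  {in r, forall i, p_congr p m (F i) 0} -> p_congr p m (\sum_(i <- r) F i) 0.
Proof.
move=> F0; rewrite big_seq -[X in p_congr _ _ _ X](@big1_eq _ _ +%R _ r (mem r)).
exact: p_congr_sum.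
Qed.

Lemma p_congr_prod (I : Type) (r : seq I) (P : pred I) (F G : I -> rat) :
  (forall i, P i -> p_congr p m (F i) (G i)) ->
  p_congr p m (\prod_(i <- r | P i) F i) (\prod_(i <- r | P i) G i).
Proof.
move=> FG; elim/big_rec2: _ => [|i x y Pi xy]; first exact/p_congr_refl/rpred1.
by apply: p_congrM => //; apply: FG.
Qed.

Lemma p_congr_cancel u x y : u != 0 -> p_integral p u^-1 ->
  p_congr p m (u * x) (u * y) -> p_congr p m x y.
Proof.
move=> u0 pu uxy; rewrite -[x](mulKf u0) -[y](mulKf u0).
by apply: p_congrM uxy; apply: p_congr_refl.
Qed.

Lemma p_congr_nat (a b : nat) : a = b %[mod m] -> p_congr p m a%:R b%:R.
Proof.
move=> ab; split; [exact: rpred_nat..|].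
have /dvdzP[k e] : (m %| a%:Z - b%:Z)%Z.
  by rewrite -eqz_mod_dvd !modz_nat ab.
exists k%:~R; first exact: rpred_int.
by rewrite !pmulrn -rmorphB e rmorphM mulrC.
Qed.

Lemma p_congr_scale x y : p_congr p m x y ->
  p_congr p (m * p) (p%:R * x) (p%:R * y).
Proof.
move=> [px py [z pz e]]; split; try by apply: rpredM => //; apply: rpred_nat.
by exists z => //; rewrite -mulrBr e natrM; ring.
Qed.

Lemma p_congr_dvd d x y :
  (d %| m)%N -> p_congr p m x y -> p_congr p d x y.
Proof.
move=> /dvdnP[k ->] [px py [z pz e]]; split=> //.
exists (k%:R * z); first by apply: rpredM pz; apply: rpred_nat.
by rewrite e natrM; ring.
Qed.

End Congr.

(** * Trinomial coefficients with a square constant term *)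

(** Since X^2 + b X + c^2 = (b + 2c) X + (X - c)^2, the term of degree j in
    (X - c)^2 contributes the middle coefficient of (X - c)^(2j). *)
Lemma trinomial_coef_sqr (R : comNzRingType) (n : nat) (b c : R) :
  trinomial_coef n b (c ^+ 2) =
  \sum_(j < n.+1) 'C(n, j)%:R * 'C(2 * j, j)%:R * (- c) ^+ j * (b + 2 * c) ^+ (n - j).
Proof.
rewrite /trinomial_coef.
have -> : 'X^2 + b *: 'X + (c ^+ 2)%:P = (b + 2 * c) *: 'X + ('X + (- c)%:P) ^+ 2 :> {poly R}.
  by rewrite -!mul_polyC !(rmorphD, rmorphM, rmorphXn, rmorphN, rmorph_nat) /=; ring.
rewrite exprDn coef_sum; apply: eq_bigr => j _.
have jn : (j <= n)%N by rewrite -ltnS.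
rewrite coefMn exprZn -exprM -scalerAl coefZ coefXnM ifF; last by lia.
rewrite subKn // (exprDn 'X) coef_sum.
have j2 : (j < (2 * j).+1)%N by lia.
rewrite (bigD1 (Ordinal j2)) //= big1 => [|i ne].
  (* Only the term i = j of (X - c)^(2j) has degree j. *)
  rewrite addr0 coefMn -rmorphXn /= coefMC coefXn.
  have -> : (2 * j - j = j)%N by lia.
  rewrite eqxx mul1r; move: (_ ^+ (n - j)) ((- c) ^+ j) => u v; ring.
rewrite coefMn -rmorphXn /= coefMC coefXn.
have -> : (j == 2 * j - i :> nat)%N = false.
  apply/eqP => e; case/eqP: ne; apply: val_inj => /=.
  have := ltn_ord i; lia.
by rewrite mul0r mul0rn.
Qed.

Definition halfbin (i : nat) : rat := 'C(2 * i, i)%:R * (- 2^-1) ^+ i.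

(** The factor (-1/2)^j comes from - c / (b + 2c) = - lambda / 2. *)
Lemma trinomial_coef_lambda (b c : int) (n : nat) : b + 2 * c != 0 ->
  (trinomial_coef n b (c ^+ 2))%:~R / (b + 2 * c)%:~R ^+ n =
  \sum_(j < n.+1) 'C(n, j)%:R * halfbin j * ((2 * c)%:~R / (b + 2 * c)%:~R) ^+ j :> rat.
Proof.
move=> m0; rewrite trinomial_coef_sqr rmorph_sum mulr_suml; apply: eq_bigr => j _.
have jn : (j <= n)%N by rewrite -ltnS.
have M0 : (b + 2 * c)%:~R != 0 :> rat by rewrite intr_eq0.
rewrite 3!rmorphM !rmorphXn !rmorph_nat /= -[in X in _ / X](subnK jn) exprD.
have -> : (- c)%:~R = - 2^-1 * (2 * c)%:~R :> rat.
  by rewrite rmorphN rmorphM /=; field.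
rewrite /halfbin !exprMn exprVn.
have := expf_neq0 j M0; have := expf_neq0 (n - j) M0.
move: (_%:~R ^+ j) (_%:~R ^+ (n - j)) ((2 * c)%:~R ^+ j) ((- 2^-1) ^+ j) => u v w t u0 v0.
by field; rewrite u0 v0.
Qed.

(** Up to the factor 2^n, this is trinomial_coef_sqr at b = 0 and c = 1, where
    the trinomial power (X^2 + 1)^n has no monomial of odd degree. *)
Lemma sum_halfbin_odd (n : nat) :
  odd n -> \sum_(i < n.+1) 'C(n, i)%:R * halfbin i = 0.
Proof.
move=> on; have := @trinomial_coef_sqr rat n 0 1.
rewrite /trinomial_coef expr1n scale0r addr0 add0r mulr1 exprDn coef_sum.
rewrite big1 => [e|i _]; last first.
  rewrite polyC1 expr1n mulr1 coefMn -exprM coefXn.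
  case: eqP => [e|_]; last by rewrite mul0rn.
  by have := congr1 odd e; rewrite on oddM.
apply: (@mulfI _ (2 ^+ n)); first by rewrite expf_neq0.
rewrite mulr0 [RHS]e mulr_sumr; apply: eq_bigr => i _.
have i_n : (i <= n)%N by rewrite -ltnS.
rewrite /halfbin -[in 2 ^+ n](subnK i_n) exprD -mulN1r exprMn exprVn.
have : 2 ^+ i != 0 :> rat by rewrite expf_neq0.
move: (2 ^+ i) => t t0; by field.
Qed.

(** * The coefficient of lambda^j, in closed form *)

(** The coefficient of lambda^j in the left-hand side of the theorem, for
    h = (p - 1)/2. *)
Definition lambda_coef (h j : nat) : rat :=
  halfbin j * \sum_(k < h.+1) 'C(2 * k, k)%:R / 4 ^+ k * 'C(2 * k, j)%:R.

Lemma sum_lambda_coef (h : nat) (l : rat) :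
  \sum_(k < h.+1) 'C(2 * k, k)%:R / 4 ^+ k *
     (\sum_(j < (2 * k).+1) 'C(2 * k, j)%:R * halfbin j * l ^+ j)
  = \sum_(j < (2 * h).+1) lambda_coef h j * l ^+ j.
Proof.
transitivity (\sum_(k < h.+1) \sum_(j < (2 * h).+1)
  'C(2 * k, k)%:R / 4 ^+ k * ('C(2 * k, j)%:R * halfbin j * l ^+ j)).
  apply: eq_bigr => k _; rewrite mulr_sumr.
  rewrite (big_ord_widen (2 * h).+1
    (fun j => 'C(2 * k, k)%:R / 4 ^+ k * ('C(2 * k, j)%:R * halfbin j * l ^+ j))).
    rewrite big_mkcond; apply: eq_bigr => j _; case: ifPn => // jk.
    by rewrite ['C(_, j)]bin_small ?mul0r ?mulr0 // ltnNge -ltnS.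
  by have := ltn_ord k; lia.
rewrite exchange_big; apply: eq_bigr => j _; rewrite /lambda_coef mulr_sumr mulr_suml.
by apply: eq_bigr => k _; ring.
Qed.

Lemma central_binS (n : nat) :
  (n.+1 * 'C(2 * n.+1, n.+1) = 2 * (2 * n + 1) * 'C(2 * n, n))%N.
Proof.
have e1 := mul_bin_diag (2 * n.+1) n.
have e2 := mul_bin_down (2 * n).+1 n.
have -> : (2 * n + 1)%N = (2 * n).+1 by lia.
have e3 : (2 * n.+1).-1 = (2 * n).+1 by lia.
have e4 : ((2 * n).+1 - n)%N = n.+1 by lia.
rewrite e3 in e1; rewrite /= e4 in e2.
by rewrite -e1 -[RHS]mulnA e2 mulnA; congr muln; lia.
Qed.

Lemma scaled_central_binS (n : nat) :
  (2 * n + 1)%:R * ('C(2 * n, n)%:R / 4 ^+ n) =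
  (2 * n + 2)%:R * ('C(2 * n.+1, n.+1)%:R / 4 ^+ n.+1) :> rat.
Proof.
have : (n.+1 * 'C(2 * n.+1, n.+1))%:R = (2 * (2 * n + 1) * 'C(2 * n, n))%:R :> rat.
  by rewrite central_binS.
rewrite !natrM.
have -> : (2 * n + 2)%:R = 2 * n.+1%:R :> rat by rewrite -natrM; congr _%:R; lia.
have : 4 ^+ n != 0 :> rat by rewrite expf_neq0.
rewrite exprS; move: (4 ^+ n) => t t0 e.
rewrite -[RHS]mulrA [n.+1%:R * (_ / _)]mulrA e; by field.
Qed.

(** The truncation F of (1 - z)^(-1/2) after z^n satisfies
    2 (1 - z) F' = F - (2n + 1) 'C(2n, n) / 4^n z^n.  At z = (1 + y)^2 this
    becomes a first-order differential equation for the generating function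
    sum_i S_i y^i, of which the recurrence is the coefficient of y^(j + 1). *)
Lemma central_sum_rec (n j : nat) :
  let S i : rat := \sum_(k < n.+1) 'C(2 * k, k)%:R / 4 ^+ k * 'C(2 * k, i)%:R in
  (2 * j + 3)%:R * S j.+1 + j.+1%:R * S j =
  (2 * n + 1)%:R * ('C(2 * n, n)%:R / 4 ^+ n) * 'C(2 * n + 1, j.+1)%:R.
Proof.
elim: n => [|n IH] /=.
  rewrite !big_ord_recr !big_ord0 /= muln0 add0n !bin0n expr0 /=.
  case: j => [|j]; rewrite ?binn ?bin_small //=.
  by rewrite !(mulr0, addr0).
rewrite !(big_ord_recr n.+1) /=; move: IH => /=.
set S1 := \sum_(_ < _) _; set S0 := \sum_(_ < _) _ => IH.
rewrite !mulrDr addrACA IH scaled_central_binS.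
have -> : (2 * n.+1 + 1 = (2 * n).+3)%N by lia.
have -> : (2 * n.+1 = (2 * n).+2)%N by lia.
have -> : (2 * n + 1 = (2 * n).+1)%N by lia.
have e1 : ((2 * n).+3 * 'C((2 * n).+2, j.+1) + j.+1 * 'C((2 * n).+3, j.+1)
   = (2 * n).+3 * 'C((2 * n).+3, j.+1))%N.
  have := mul_bin_down (2 * n).+3 j.+1.
  have [l|g] := leqP j.+1 (2 * n).+3; first by move=> /= ->; rewrite -mulnDl subnK.
  by rewrite !bin_small //; lia.
have e2 : ((2 * n).+2 * 'C((2 * n).+1, j.+1) + j.+1 * 'C((2 * n).+2, j.+1)
   = (2 * n).+2 * 'C((2 * n).+2, j.+1))%N.
  have := mul_bin_down (2 * n).+2 j.+1.
  have [l|g] := leqP j.+1 (2 * n).+2; first by move=> /= ->; rewrite -mulnDl subnK.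
  by rewrite !bin_small //; lia.
have e3 := binS (2 * n).+2 j.
have e4 : ((2 * j + 3) * 'C((2 * n).+2, j.+1) + j.+1 * 'C((2 * n).+2, j)
   + (2 * n).+2 * 'C((2 * n).+1, j.+1) = (2 * n).+3 * 'C((2 * n).+3, j.+1))%N.
  by nia.
have {}e4 := congr1 (fun i => i%:R : rat) e4; move: e4.
rewrite addn2 [in X in X -> _]natrD [in X in _ = X -> _]natrM natrD !natrM => e.
move: (_ / 4 ^+ n.+1) => a; rewrite [RHS]mulrAC -e; ring.
Qed.

Lemma central_sum0 (n : nat) :
  \sum_(k < n.+1) 'C(2 * k, k)%:R / 4 ^+ k * 'C(2 * k, 0)%:R =
  (2 * n + 1)%:R * ('C(2 * n, n)%:R / 4 ^+ n) :> rat.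
Proof.
elim: n => [|n IH]; first by rewrite big_ord_recr big_ord0 /= bin0; field.
rewrite big_ord_recr IH scaled_central_binS bin0 /= !natrD !natrM; ring.
Qed.

(** The weight halfbin j is chosen so that (j + 1) halfbin (j + 1) is
    - (2j + 1) halfbin j: multiplying central_sum_rec by halfbin (j + 1) then
    expresses the difference of two consecutive left-hand sides. *)
Lemma lambda_coefE (n j : nat) :
  (2 * j + 1)%:R * lambda_coef n j =
  (2 * n + 1)%:R * ('C(2 * n, n)%:R / 4 ^+ n) *
    \sum_(i < j.+1) 'C(2 * n + 1, i)%:R * halfbin i.
Proof.
rewrite /lambda_coef; elim: j => [|j IH].
  by rewrite central_sum0 big_ord_recr big_ord0 /= !bin0 /halfbin bin0; ring.
rewrite [in RHS]big_ord_recr /= [RHS]mulrDr -IH [X in _ = _ + X]mulrA -central_sum_rec.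
set S1 := \sum_(_ < _) _; set S0 := \sum_(_ < _) _.
have -> : (2 * j.+1 + 1 = 2 * j + 3)%N by lia.
have e : j.+1%:R * halfbin j.+1 = - (2 * j + 1)%:R * halfbin j.
  rewrite /halfbin mulrA -natrM central_binS exprS !natrM; by field.
rewrite [in RHS]mulrDl [j.+1%:R * S0 * _]mulrAC e.
move: (2 * j + 1)%:R (2 * j + 3)%:R (halfbin j) (halfbin j.+1) => u v x y; ring.
Qed.

(** * Binomial coefficients modulo p and p^2 *)

Lemma prime_coprime_fact (p n : nat) : prime p -> (n < p)%N -> coprime p n`!.
Proof.
move=> pp; elim: n => [|n IH] np; first by rewrite coprimen1.
by rewrite factS coprimeMr IH ?(ltnW np) // andbT prime_coprime // gtnNdvd.
Qed.

Lemma coprime_central_bin (h : nat) :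
  prime (2 * h).+1 -> coprime (2 * h).+1 'C(2 * h, h).
Proof.
move=> pp; apply: (coprime_dvdr (n := (2 * h)`!)); last exact: prime_coprime_fact.
have hh : (h <= 2 * h)%N by lia.
by rewrite -(bin_fact hh) dvdn_mulr.
Qed.

Lemma fact_double (h : nat) :
  ((2 * h)`! = 2 ^ h * h`! * \prod_(i < h) (2 * i + 1))%N.
Proof.
elim: h => [|h IH]; first by rewrite big_ord0.
rewrite big_ord_recr /= (_ : 2 * h.+1 = (2 * h).+2)%N; last by lia.
rewrite !factS IH expnS; ring.
Qed.

Lemma central_bin_odd_prod (h : nat) :
  ('C(2 * h, h) * h`! = 2 ^ h * \prod_(i < h) (2 * i + 1))%N.
Proof.
have hh : (h <= 2 * h)%N by lia.
apply/eqP; rewrite -(eqn_pmul2r (fact_gt0 h)).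
have -> : (2 ^ h * \prod_(i < h) (2 * i + 1) * h`! = (2 * h)`!)%N.
  by rewrite fact_double mulnAC.
rewrite -(bin_fact hh) -mulnA (_ : 2 * h - h = h)%N //; lia.
Qed.

(** Morley's congruence modulo p^2, where p = 2h + 1 and 16^h = 4^(p - 1).
    The number h! 'C(2h, h) is both the product of p - i and 2^h times the
    product of p - 2i, for 1 <= i <= h.  As (p - 2i)^2 = - 4i (p - i) modulo
    p^2, squaring the second product and comparing with the first determines
    'C(2h, h). *)
Lemma central_bin_mod_p2 (h : nat) : prime (2 * h).+1 ->
  p_congr (2 * h).+1 ((2 * h).+1 ^ 2) 'C(2 * h, h)%:R ((- 16) ^+ h).
Proof.
move=> pp; set p := (2 * h).+1.
have hp : (h < p)%N by rewrite /p; lia.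
have cf := prime_coprime_fact pp hp; have cC := coprime_central_bin pp.
have nz n : coprime p n -> n%:R != 0 :> rat.
  rewrite pnatr_eq0; apply: contraTneq => ->.
  by rewrite /coprime gcdn0 gtn_eqF // prime_gt1.
set f : rat := (h`!)%:R; set C : rat := 'C(2 * h, h)%:R.
apply: (@p_congr_cancel _ _ (f * C * f)).
- by rewrite !mulf_neq0 ?nz.
- by rewrite -!natrM; apply: p_integral_natV; rewrite !coprimeMr cf cC.
have eodd : f * C = 2 ^+ h * \prod_(i < h) (p%:R - 2 * i.+1%:R).
  rewrite /f /C -natrM mulnC central_bin_odd_prod natrM natrX natr_prod.
  (* The odd numbers below p are the p - 2i, in reverse order. *)
  congr (_ * _); rewrite (reindex_inj rev_ord_inj) /=; apply: eq_bigr => i _.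
  apply/eqP; rewrite eq_sym subr_eq -natrM -natrD eqr_nat /p.
  have := ltn_ord i; lia.
have eall : C * f = \prod_(i < h) (p%:R - i.+1%:R).
  rewrite /f /C -natrM bin_ffact ffact_prod natr_prod; apply: eq_bigr => i _.
  by rewrite -natrB ?subSS // ltnS; have := ltn_ord i; lia.
have efact : f = \prod_(i < h) i.+1%:R.
  by rewrite /f fact_prod big_add1 big_mkord natr_prod.
have -> : f * C * f * C = 4 ^+ h * \prod_(i < h) (p%:R - 2 * i.+1%:R) ^+ 2.
  rewrite -mulrA [f * C in X in _ * X]mulrC -[C * f]mulrC -expr2 eodd exprMn -prodrXl.
  by rewrite -exprM mulnC exprM; congr (_ ^+ h * _); ring.
have -> : f * C * f * (- 16) ^+ h =
          4 ^+ h * \prod_(i < h) (- 4 * i.+1%:R * (p%:R - i.+1%:R)).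
  rewrite 2!big_split /= -efact -eall prodr_const card_ord.
  rewrite (_ : - 16 = 4 * - 4) ?exprMn; last by ring.
  by move: (4 ^+ h) ((- 4) ^+ h) => u v; ring.
apply: p_congrM; first by apply: p_congr_refl; apply: rpredX; apply: rpred_nat.
apply: p_congr_prod => i _.
have ir (k : nat) : p_integral p k%:R by apply: rpred_nat.
have ib : p_integral p (p%:R - i.+1%:R) by apply: rpredB; apply: ir.
split.
- by apply/rpredX/rpredB; [|apply: rpredM]; apply: ir.
- by apply: rpredM ib; apply: rpredM (ir _); apply: rpredNr; apply: ir.
- by exists 1; [apply: rpred1 | rewrite natrX; ring].
Qed.

Lemma fermat_half (h : nat) : prime (2 * h).+1 -> (0 < h)%N ->
  p_congr (2 * h).+1 (2 * h).+1 (4 ^+ h) 1.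
Proof.
move=> pp h0; rewrite -natrX; apply: (@p_congr_nat _ _ _ 1).
have := @Euler_exp_totient 2 (2 * h).+1; rewrite totient_prime //= => <-.
  by rewrite expnM.
by rewrite coprime2n /= oddM.
Qed.

(** In the Vandermonde sum of 'C(p, i) 'C(p, p - i), all terms but the first and
    the last are divisible by p^2. *)
Lemma bin_double_p (p : nat) : prime p -> 'C(2 * p, p) = 2 %[mod p ^ 2].
Proof.
case: p => // q; set p := q.+1 => pp.
rewrite mul2n -addnn -binomial.Vandermonde big_ord_recr big_ord_recl /= subn0 subnn.
rewrite !bin0 !binn !muln1.
have /dvdnP[k ->] : (p ^ 2 %| \sum_(i < q) 'C(p, bump 0 i) * 'C(p, p - bump 0 i))%N.
  apply: dvdn_sum => i _; have := ltn_ord i => ip.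
  apply: dvdn_mul; apply: prime_dvd_bin => //; rewrite /bump; lia.
by rewrite -addnA addnC -addnA modnMDl.
Qed.

Lemma dvdn_central_bin (h i : nat) : prime (2 * h).+1 -> (h < i < (2 * h).+1)%N ->
  ((2 * h).+1 %| 'C(2 * i, i))%N.
Proof.
move=> pp /andP[hi ip].
have hh : (i <= 2 * i)%N by lia.
have : ((2 * h).+1 %| (2 * i)`!)%N by apply: dvdn_fact; lia.
rewrite -(bin_fact hh) (_ : 2 * i - i = i)%N; last by lia.
by rewrite Gauss_dvdl // coprimeMr prime_coprime_fact.
Qed.

(** * The coefficient of lambda^j modulo p^2 *)

Section OddPrime.
Variable h : nat.
Let p := (2 * h).+1.
Hypothesis p_prime : prime p.

Lemma coprime_p_2 : coprime p 2.
Proof. by rewrite coprimen2 /p /= oddM. Qed.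

Lemma p_integral_halfbin (i : nat) : p_integral p (halfbin i).
Proof.
apply: rpredM; first exact: rpred_nat.
by apply/rpredX/rpredNr/p_integral_natV/coprime_p_2.
Qed.

Lemma halfbin_sum_mod_p (j : nat) : (j < p)%N ->
  p_congr p p (\sum_(i < j.+1) 'C(p, i)%:R * halfbin i) 1.
Proof.
move=> jp; rewrite big_ord_recl /= /halfbin bin0 expr0 !mulr1 -[X in p_congr _ _ _ X]addr0.
apply: p_congrD; first exact/p_congr_refl/rpred1.
apply: p_congr_sum0 => i _.
rewrite -[X in p_congr _ _ _ X](mul0r (halfbin (bump 0 i))).
apply: p_congrM; last exact/p_congr_refl/p_integral_halfbin.
apply: (@p_congr_nat _ _ _ 0); apply/eqP; rewrite mod0n; apply: prime_dvd_bin => //.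
by rewrite /bump /=; have := ltn_ord i; lia.
Qed.

(** The complete sum, up to i = p, vanishes, so the partial sum is the opposite
    of the remaining one; there, p divides both 'C(p, i) and 'C(2i, i) as long as
    h < i < p, and the term i = p is 'C(2p, p) (-1/2)^p. *)
Lemma halfbin_sum_mid_mod_p2 :
  p_congr p (p ^ 2) (\sum_(i < h.+1) 'C(p, i)%:R * halfbin i) (4 ^- h).
Proof.
have odd_p : odd p by rewrite /p /= oddM.
have := sum_halfbin_odd odd_p.
rewrite -(big_mkord xpredT (fun i => 'C(p, i)%:R * halfbin i)).
rewrite (@big_cat_nat _ _ _ h.+1) //=; last by rewrite /p; lia.
rewrite big_mkord big_nat_recr /=; last by rewrite /p; lia.
move/eqP; rewrite addr_eq0 => /eqP->.
(* The summands 0 and 1 * (2 * _) match h < i < p and i = p. *)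
have -> : 4 ^- h = - (0 + 1 * (2 * (- 2^-1) ^+ p)) :> rat.
  rewrite /p exprS exprM (_ : (- 2^-1) ^+ 2 = 4^-1); last by field.
  by rewrite exprVn; field; rewrite expf_neq0.
apply: p_congrN; apply: p_congrD.
  apply: p_congr_sum0 => i; rewrite mem_index_iota => hip.
  rewrite /halfbin mulrA -natrM -[X in p_congr _ _ _ X](mul0r ((- 2^-1) ^+ i)).
  apply: p_congrM; last first.
    by apply/p_congr_refl/rpredX/rpredNr/p_integral_natV/coprime_p_2.
  apply: (@p_congr_nat _ _ _ 0); apply/eqP; rewrite mod0n; apply: dvdn_mul.
    by apply: prime_dvd_bin => //; lia.
  by apply: dvdn_central_bin.
rewrite binn; apply: p_congrM; first exact/p_congr_refl/rpred1.
apply: p_congrM; first exact/p_congr_nat/bin_double_p.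
by apply/p_congr_refl/rpredX/rpredNr/p_integral_natV/coprime_p_2.
Qed.

Lemma scaled_central_bin_mod_p2 :
  p_congr p (p ^ 2) ('C(2 * h, h)%:R / 4 ^+ h) ((- 4) ^+ h).
Proof.
have -> : (- 4) ^+ h = (- 16) ^+ h / 4 ^+ h :> rat.
  rewrite (_ : - 16 = (- 4) * 4) ?exprMn; last by ring.
  by rewrite mulfK ?expf_neq0.
apply: p_congrM; first exact: central_bin_mod_p2.
apply: p_congr_refl; rewrite -natrX; apply: p_integral_natV.
by apply: coprimeXr; rewrite (coprimeMr p 2 2) coprime_p_2.
Qed.

(** The factor 2j + 1 = p of lambda_coefE cancels exactly against the p on the
    other side, so no precision is lost. *)
Lemma lambda_coef_mid : p_congr p (p ^ 2) (lambda_coef h h) ((- 1) ^+ h).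
Proof.
have := lambda_coefE h h; rewrite addn1 -/p -mulrA.
have p0 : p%:R != 0 :> rat by rewrite pnatr_eq0.
move/(mulfI p0) => ->.
have -> : (-1) ^+ h = (- 4) ^+ h * 4 ^- h :> rat.
  by rewrite -[- 4]mulN1r exprMn mulfK ?expf_neq0.
by apply: p_congrM halfbin_sum_mid_mod_p2; apply: scaled_central_bin_mod_p2.
Qed.

Lemma p_integral_oddV (j : nat) : (j < p)%N -> j != h -> p_integral p (2 * j + 1)%:R^-1.
Proof.
move=> jp jh; apply: p_integral_natV; rewrite prime_coprime //.
apply/negP => /dvdnP[k]; rewrite /p; move/eqP: jh => jh e.
(* The odd number 2j + 1 < 2p could only be the multiple p itself. *)
have : (k = 0 \/ k = 1 \/ k >= 2)%N by lia.
move: jp; rewrite /p => jp; case=> [k0|[k1|k2]]; nia.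
Qed.

Lemma lambda_coef_off_mid (j : nat) : (j < p)%N -> j != h -> (0 < h)%N ->
  p_congr p (p ^ 2) (lambda_coef h j) ((- 1) ^+ h * p%:R / (2 * j + 1)%:R).
Proof.
move=> jp jh h0; have pj := p_integral_oddV jp jh.
have j0 : (2 * j + 1)%:R != 0 :> rat by rewrite pnatr_eq0 addn1.
apply: (p_congr_cancel j0 pj).
rewrite lambda_coefE (addn1 (2 * h)) -/p [X in p_congr _ _ _ X]mulrC divfK //.
rewrite [(-1) ^+ h * _]mulrC -mulrA (_ : p ^ 2 = p * p)%N //; apply: p_congr_scale.
rewrite -[X in p_congr _ _ _ X]mulr1.
apply: p_congrM; last exact: halfbin_sum_mod_p.
apply: p_congr_trans (p_congr_dvd (dvdn_mulr _ (dvdnn p)) scaled_central_bin_mod_p2) _.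
rewrite -[- 4]mulN1r exprMn -[X in p_congr _ _ _ X]mulr1; apply: p_congrM.
  by apply/p_congr_refl/rpredX/rpredN1.
exact: fermat_half.
Qed.

End OddPrime.

(** * The congruence *)

Theorem theorem1p1 (p : nat) (b c : int)
  (p_prime : prime p) (p_gt3 : (3 < p)%N)
  (p_ndvd : ~~ (p%:Z %| b + 2 * c)%Z) :
  let lambda : rat := (2 * c)%:~R / (b + 2 * c)%:~R in
  p_congr p (p ^ 2)
    (\sum_(0 <= k < ((p - 1) %/ 2).+1)
       'C(2 * k, k)%:R / (4 ^+ k * (b + 2 * c)%:~R ^+ (2 * k))
       * (trinomial_coef (2 * k) b (c ^+ 2))%:~R)
    ((- lambda) ^+ ((p - 1) %/ 2)
     + (-1) ^+ ((p - 1) %/ 2) * p%:R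
       * \sum_(0 <= j < p | j != ((p - 1) %/ 2)%N)
           lambda ^+ j / (2 * j + 1)%:R).
Proof.
move=> lambda; set h := ((p - 1) %/ 2)%N.
have ep : p = (2 * h).+1.
  by have := even_prime p_prime; rewrite /h; lia.
have h0 : (0 < h)%N by lia.
have hp : (h < p)%N by lia.
have m0 : b + 2 * c != 0 by apply: contraNneq p_ndvd => ->; rewrite dvdz0.
have pl : p_integral p lambda.
  apply: p_integral_div; rewrite prime_coprime //.
clearbody h; subst p.
have -> : \sum_(0 <= k < h.+1) 'C(2 * k, k)%:R / (4 ^+ k * (b + 2 * c)%:~R ^+ (2 * k))
       * (trinomial_coef (2 * k) b (c ^+ 2))%:~R =
       \sum_(j < (2 * h).+1) lambda_coef h j * lambda ^+ j.
  rewrite -sum_lambda_coef big_mkord; apply: eq_bigr => k _.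
  by rewrite -trinomial_coef_lambda // invfM; ring.
(* The index j = h is split off on the left, matching the right-hand side. *)
clearbody lambda; rewrite (bigD1 (Ordinal hp)) //= big_mkord mulr_sumr.
apply: p_congrD.
  rewrite -[- lambda]mulN1r exprMn; apply: p_congrM; first exact: lambda_coef_mid.
  exact/p_congr_refl/rpredX.
apply: p_congr_sum => j jh.
rewrite [X in p_congr _ _ _ X]mulrCA [X in p_congr _ _ _ X]mulrC.
apply: p_congrM; last exact/p_congr_refl/rpredX.
exact: lambda_coef_off_mid.
Qed.
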